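(* Let $(\hat{\mathcal G}(A,D),p,\mathcal V_a)$ be a sensor network in $\mathbb R^2$ such that Problem 1 is feasible, $\mathcal V_a\cap\mathcal V_A\ne\emptyset$ and $\mathcal V_a\cap\mathcal V_D\neq\emptyset$. If $\mathcal T_{\hat A}$ is connected over $\hat{\mathcal G}$, then: 1) the sensor network is SA-RoD localizable if and only if $\operatorname{rank}(C_D)=m$; 2) if $\operatorname{rank}(C_D)=m$, then the following algorithm solves Problem 1: find the bearings $b_{ij}$ of all edges by solving the linear system (S1); find the distances $d$ of all edges by solving the linear system $C_Dd=y$; compute $x=\mathbf 1_n\otimes p_l+(P_l\odot B)d$ for an anchor $l\in\mathcal V_a$.
   Context: Sensor network: $\mathcal V=\{1,\dots,n\}=\mathcal V_a\cup\mathcal V_f$ (anchors $\mathcal V_a=\{1,\dots,n_a\}$, free nodes $\mathcal V_f$), $n\ge3$; $\mathcal G=(\mathcal V,\mathcal E)$ is a connected simple undirected graph with a node bipartition $\mathcal V=\mathcal V_A\cup\mathcal V_D$ ($\mathcal V_A,\mathcal V_D$ disjoint and nonempty). True locations: $p=(p_1^\top,\dots,p_n^\top)^\top\in\mathbb R^{2n}$, pairwise distinct $p_i\in\mathbb R^2$. $\hat{\mathcal G}=(\mathcal V,\hat{\mathcal E})$, where $\hat{\mathcal E}$ is $\mathcal E$ together with all edges between pairs of distinct anchors; $m=|\hat{\mathcal E}|$; an orientation of $\hat{\mathcal G}$ is fixed. $\mathcal T_{\hat A}=\{(u,v,w)\in\mathcal V^3:u\in\mathcal V_A,(u,v),(u,w)\in\hat{\mathcal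 E},v<w\}$; $\mathcal T_{\hat D}$ likewise with $u\in\mathcal V_D$. Measurements: for $(i,j,k)\in\mathcal T_{\hat A}$, $\theta_{ijk}\in[0,2\pi)$ is the counter-clockwise signed angle from $p_j-p_i$ to $p_k-p_i$; for $(r,s,t)\in\mathcal T_{\hat D}$, $\kappa_{rst}=\|p_t-p_r\|/\|p_s-p_r\|$. $\mathcal R(\theta)$ is the counter-clockwise rotation matrix. Problem 1: find $x\in\mathbb R^{2n}$ (with $x_i\ne x_j$ for $(i,j)\in\hat{\mathcal E}$) such that $\frac{x_k-x_i}{\|x_k-x_i\|}=\mathcal R(\theta_{ijk})\frac{x_j-x_i}{\|x_j-x_i\|}$ for $(i,j,k)\in\mathcal T_{\hat A}$, $\frac{\|x_t-x_r\|}{\|x_s-x_r\|}=\kappa_{rst}$ for $(r,s,t)\in\mathcal T_{\hat D}$, and $x_i=p_i$ for $i\in\mathcal V_a$. The network is SA-RoD localizable if Problem 1 has a unique feasible solution. $\mathcal T_{\hat A}$ is connected over $\hat{\mathcal G}$ if the following graph is connected: its vertices are the edges of $\hat{\mathcal G}$; edges $\{i,j\},\{i,k\}$ ($j\neq k$) are adjacent iff $(i,j,k)$ or $(i,k,j)$ is in $\mathcal T_{\hat A}$. (S1): $b_{ik}-\mathcal R(\theta_{ijk})b_{ij}=0$ for $(i,j,k)\in\mathcal T_{\hat A}$, and $b_{ij}=\frac{p_j-p_i}{\|p_j-p_i\|}$ for distinct $i,j\in\mathcal V_a$, with unknowns $b_{ij}\in\mathbb R^2$, one per edge of $\hat{\mathcal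 E}$, convention $b_{ji}=-b_{ij}$. $B\in\mathbb R^{2\times m}$ has columns the edge bearings $b_{ij}$ (along the orientation), i.e. $b_{ij}=\frac{p_j-p_i}{\|p_j-p_i\|}$ (in the algorithm: the solution of (S1)). $C\in\{0,\pm1\}^{(m-n+1)\times m}$ is a cycle basis matrix of $\hat{\mathcal G}$: its rows are signed characteristic vectors of cycles forming a basis of the cycle space. $\odot$ is the Khatri–Rao (columnwise Kronecker) product; $C_b=C\odot B\in\mathbb R^{2(m-n+1)\times m}$. $D_0$ has $m$ columns (indexed by edges) and the following rows: for each $(i,j,k)\in\mathcal T_{\hat D}$ a row with $-\kappa_{ijk}$ in column $(i,j)$, $1$ in column $(i,k)$ and zeros elsewhere; for each pair of distinct anchors $s,t$ a row with $1$ in column $(s,t)$ and zeros elsewhere. $C_D=(C_b^\top,D_0^\top)^\top$; $y$ is the vector with entries $\|p_s-p_t\|$ in the rows indexed by anchor pairs and $0$ elsewhere. $d\in\mathbb R^m$ is the vector of edge lengths ($d_{ij}=d_{ji}$). Path matrix $P_l\in\{0,\pm1\}^{n\times m}$ with base vertex $l$: for a fixed spanning tree of $\hat{\mathcal G}$, entry $(i,j)$ is $1$ (resp. $-1$) if the $j$-th edge lies on the tree path from $l$ to $i$ with orientation agreeing (resp. opposite), and $0$ otherwise. *)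

(* Defs.v *)
From HB Require Import structures.
From mathcomp Require Import all_boot all_order all_algebra.
From mathcomp Require Import reals trigo mxtens.

Set Implicit Arguments.
Unset Strict Implicit.
Unset Printing Implicit Defensive.

Import Order.TTheory GRing.Theory Num.Theory.
Local Open Scope ring_scope.

(* The Euclidean norm; the library norm on matrices is the sup norm. *)
Definition enorm (R : realType) (d : nat) (v : 'cV[R]_d) : R :=
  Num.sqrt (\sum_a v a 0 ^+ 2).

Definition unitv (R : realType) (d : nat) (v : 'cV[R]_d) : 'cV[R]_d :=
  (enorm v)^-1 *: v.

Definition rot (R : realType) (t : R) : 'M[R]_2 :=
  \matrix_(a < 2, b < 2)
    if a == b then cos t else if (a < b)%N then - sin t else sin t.

Definition is_ccw_angle (R : realType) (t : R) (u v : 'cV[R]_2) : Prop :=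
  0 <= t < pi *+ 2 /\ unitv v = rot t *m unitv u.

Definition khatri_rao (R : realType) (a b m : nat)
    (M : 'M[R]_(a, m)) (N : 'M[R]_(b, m)) : 'M[R]_(a * b, m) :=
  \matrix_(r, k) (col k M *t col k N) r ord0.

(* A configuration x in R^(2n) is the stacking of n vectors of R^2. *)
Definition loc (R : realType) (n : nat) (x : 'cV[R]_(n * 2)) (i : 'I_n) :
    'cV[R]_2 :=
  \col_a x (mxtens_index (i, a)) 0.

Definition bearing (R : realType) (n : nat) (x : 'cV[R]_(n * 2))
    (i j : 'I_n) : 'cV[R]_2 :=
  unitv (loc x j - loc x i).

Definition edge_len (R : realType) (n : nat) (x : 'cV[R]_(n * 2))
    (i j : 'I_n) : R :=
  enorm (loc x j - loc x i).

(* Nodes are numbered from 0, so the anchors are the i < na. *)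
Definition anchors (n na : nat) : {set 'I_n} := [set i : 'I_n | (i < na)%N].

Definition connected_graph (n : nat) (g : rel 'I_n) : Prop :=
  forall i j, connect g i j.

(* The edge relation of the graph G-hat. *)
Definition hat (n na : nat) (g : rel 'I_n) : rel 'I_n :=
  fun i j => g i j || [&& i != j, i \in anchors n na & j \in anchors n na].

Definition edge_set (n : nat) (g : rel 'I_n) : {set {set 'I_n}} :=
  [set [set ij.1; ij.2] | ij : 'I_n * 'I_n & g ij.1 ij.2].

(* With g := hat na e, these are the index sets of the signed angles (U = V_A)
   and of the ratios of distances (U = V_D). *)
Definition triples (n : nat) (g : rel 'I_n) (U : {set 'I_n}) :
    {set 'I_n * 'I_n * 'I_n} :=
  [set t | [&& t.1.1 \in U, g t.1.1 t.1.2, g t.1.1 t.2 & (t.1.2 < t.2)%N]].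

Definition anchor_pairs (n na : nat) : {set 'I_n * 'I_n} :=
  [set st | [&& st.1 \in anchors n na, st.2 \in anchors n na
              & (st.1 < st.2)%N]].

Definition triple_adj (n : nat) (T : {set 'I_n * 'I_n * 'I_n}) :
    rel {set 'I_n} :=
  fun e f => [exists i, exists j, exists k,
    [&& j != k, e == [set i; j], f == [set i; k]
      & ((i, j, k) \in T) || ((i, k, j) \in T)]].

Definition triples_connected (n : nat) (g : rel 'I_n)
    (T : {set 'I_n * 'I_n * 'I_n}) : Prop :=
  {in edge_set g &, forall e f, connect (triple_adj T) e f}.

Definition feasible (R : realType) (n na : nat) (g : rel 'I_n)
    (VA VD : {set 'I_n}) (theta kappa : 'I_n -> 'I_n -> 'I_n -> R)
    (p x : 'cV[R]_(n * 2)) : Prop :=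
  [/\ forall i j, g i j -> loc x i <> loc x j,
      forall i j k, (i, j, k) \in triples g VA ->
        bearing x i k = rot (theta i j k) *m bearing x i j,
      forall r s t, (r, s, t) \in triples g VD ->
        edge_len x r t / edge_len x r s = kappa r s t
    & forall i, i \in anchors n na -> loc x i = loc p i].

Definition sarod_localizable (R : realType) (n na : nat) (g : rel 'I_n)
    (VA VD : {set 'I_n}) (theta kappa : 'I_n -> 'I_n -> 'I_n -> R)
    (p : 'cV[R]_(n * 2)) : Prop :=
  exists! x, feasible na g VA VD theta kappa p x.

(* o numbers the edges of g by 'I_m and orients them: the k-th edge goes from
   (o k).1 to (o k).2. *)
Definition orientation (n m : nat) (g : rel 'I_n) (o : 'I_m -> 'I_n * 'I_n) :
    Prop :=
  injective (fun k => [set (o k).1; (o k).2])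
  /\ [set [set (o k).1; (o k).2] | k : 'I_m] = edge_set g.

(* 1 if the k-th edge is (i, j), -1 if it is (j, i), and 0 otherwise. *)
Definition edge_sign (R : realType) (n m : nat) (o : 'I_m -> 'I_n * 'I_n)
    (k : 'I_m) (i j : 'I_n) : R :=
  (o k == (i, j))%:R - (o k == (j, i))%:R.

Definition is_edge (n m : nat) (o : 'I_m -> 'I_n * 'I_n)
    (k : 'I_m) (i j : 'I_n) : bool :=
  [set (o k).1; (o k).2] == [set i; j].

Definition bearing_mx (R : realType) (n m : nat) (o : 'I_m -> 'I_n * 'I_n)
    (p : 'cV[R]_(n * 2)) : 'M[R]_(2, m) :=
  \matrix_(a, k) bearing p (o k).1 (o k).2 a 0.

(* b_ij, for the unknown bearings stored as the columns of B; only one term of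
   the sum is nonzero, and b_ji = - b_ij. *)
Definition edge_bearing (R : realType) (n m : nat) (o : 'I_m -> 'I_n * 'I_n)
    (B : 'M[R]_(2, m)) (i j : 'I_n) : 'cV[R]_2 :=
  \sum_k edge_sign R o k i j *: col k B.

Definition S1 (R : realType) (n na m : nat) (g : rel 'I_n) (VA : {set 'I_n})
    (theta : 'I_n -> 'I_n -> 'I_n -> R) (o : 'I_m -> 'I_n * 'I_n)
    (p : 'cV[R]_(n * 2)) (B : 'M[R]_(2, m)) : Prop :=
  (forall i j k, (i, j, k) \in triples g VA ->
     edge_bearing o B i k - rot (theta i j k) *m edge_bearing o B i j = 0)
  /\ (forall i j, i \in anchors n na -> j \in anchors n na -> i <> j ->
        edge_bearing o B i j = bearing p i j).

(* Without the bound on the size, an edge traversed back and forth would be a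
   cycle. *)
Definition graph_cycle (n : nat) (g : rel 'I_n) (c : seq 'I_n) : Prop :=
  (2 < size c)%N /\ ucycle g c.

(* next c u = v says that v follows u on the cycle c, for v <> u. *)
Definition cycle_vec (R : realType) (n m : nat) (o : 'I_m -> 'I_n * 'I_n)
    (c : seq 'I_n) : 'rV[R]_m :=
  \row_k ((next c (o k).1 == (o k).2)%:R - (next c (o k).2 == (o k).1)%:R).

Definition incidence_mx (R : realType) (n m : nat) (o : 'I_m -> 'I_n * 'I_n) :
    'M[R]_(m, n) :=
  \matrix_(k, i) (((o k).2 == i)%:R - ((o k).1 == i)%:R).

(* The cycle space consists of the row vectors v with v *m incidence_mx = 0. *)
Definition cycle_space (R : realType) (n m : nat) (o : 'I_m -> 'I_n * 'I_n) :
    'M[R]_m :=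
  kermx (incidence_mx R o).

Definition cycle_basis_mx (R : realType) (n m c : nat) (g : rel 'I_n)
    (o : 'I_m -> 'I_n * 'I_n) (C : 'M[R]_(c, m)) : Prop :=
  [/\ forall r, exists2 s, graph_cycle g s & row r C = cycle_vec R o s,
      row_free C
    & (C == cycle_space R o)%MS].

Definition D0 (R : realType) (n na m : nat) (g : rel 'I_n) (VD : {set 'I_n})
    (kappa : 'I_n -> 'I_n -> 'I_n -> R) (o : 'I_m -> 'I_n * 'I_n) :
    'M[R]_(#|triples g VD| + #|anchor_pairs n na|, m) :=
  col_mx
    (\matrix_(r, k) let: (i, j, l) := enum_val r in
       - kappa i j l * (is_edge o k i j)%:R + (is_edge o k i l)%:R)
    (\matrix_(r, k) let: (s, t) := enum_val r in (is_edge o k s t)%:R).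

Definition CD (R : realType) (n na m c : nat) (g : rel 'I_n) (VD : {set 'I_n})
    (kappa : 'I_n -> 'I_n -> 'I_n -> R) (o : 'I_m -> 'I_n * 'I_n)
    (C : 'M[R]_(c, m)) (B : 'M[R]_(2, m)) :
    'M[R]_(c * 2 + (#|triples g VD| + #|anchor_pairs n na|), m) :=
  col_mx (khatri_rao C B) (D0 na g VD kappa o).

Definition yvec (R : realType) (n na c : nat) (g : rel 'I_n) (VD : {set 'I_n})
    (p : 'cV[R]_(n * 2)) :
    'cV[R]_(c * 2 + (#|triples g VD| + #|anchor_pairs n na|)) :=
  col_mx 0 (col_mx 0
    (\col_r let: (s, t) := enum_val r in edge_len p s t)).

Definition spanning_tree (n : nat) (g tr : rel 'I_n) : Prop :=
  [/\ symmetric tr, subrel tr g, connected_graph tr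
    & forall c, ~ graph_cycle tr c].

(* l :: s is the tree path from l to i, and zip (l :: s) s lists its arcs. *)
Definition path_matrix (R : realType) (n m : nat) (tr : rel 'I_n)
    (o : 'I_m -> 'I_n * 'I_n) (l : 'I_n) (P : 'M[R]_(n, m)) : Prop :=
  forall i s, path tr l s -> uniq (l :: s) -> last l s = i ->
  forall k, P i k = (((o k).1, (o k).2) \in zip (l :: s) s)%:R
                    - (((o k).2, (o k).1) \in zip (l :: s) s)%:R.

Definition reconstruct (R : realType) (n m : nat) (p : 'cV[R]_(n * 2))
    (l : 'I_n) (P : 'M[R]_(n, m)) (B : 'M[R]_(2, m)) (d : 'cV[R]_m) :
    'cV[R]_(n * 2) :=
  ((const_mx 1 : 'cV[R]_n) *t loc p l) + khatri_rao P B *m d.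

(* Each of the two linear systems has exactly one solution, and whichever
   anchor, spanning tree and path matrix are used, the point computed from
   these solutions is a solution of the localization problem. *)
Definition algorithm_solves (R : realType) (n na m c : nat) (g : rel 'I_n)
    (VA VD : {set 'I_n}) (theta kappa : 'I_n -> 'I_n -> 'I_n -> R)
    (o : 'I_m -> 'I_n * 'I_n) (C : 'M[R]_(c, m)) (p : 'cV[R]_(n * 2)) : Prop :=
  (exists! B, S1 na g VA theta o p B)
  /\ forall B, S1 na g VA theta o p B ->
     (exists! d, CD na g VD kappa o C B *m d = yvec na c g VD p)
     /\ forall d, CD na g VD kappa o C B *m d = yvec na c g VD p ->
        forall l tr P, l \in anchors n na -> spanning_tree g tr ->
          path_matrix tr o l P ->
          feasible na g VA VD theta kappa p (reconstruct p l P B d).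

(* Main.v *)
Require Import Defs.
From mathcomp Require Import all_boot all_order all_algebra.
From mathcomp Require Import reals trigo mxtens ring lra.

Set Implicit Arguments.
Unset Strict Implicit.
Unset Printing Implicit Defensive.

Import Order.TTheory GRing.Theory Num.Theory.
Local Open Scope ring_scope.

(** By connectivity of the angle triples, the bearing of one edge between two
    anchors determines all edge bearings, so every feasible point has the
    bearings of p, and only the edge lengths d are unknown.  The cycle rows say
    that the edge vectors d_k b_k are orthogonal to the cycle space, that is,
    that they are the differences of a configuration; hence the positive
    solutions of C_D d = y are exactly the length vectors of the feasible
    points.  If the rank is m, then d, and with it x, is unique.  Otherwise a
    small multiple of a kernel vector can be added to the lengths of p without
    losing positivity, which gives a second feasible point. *)

Lemma set2_eq (T : finType) (a b c d : T) :
  [set a; b] = [set c; d] -> (a, b) = (c, d) \/ (a, b) = (d, c).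
Proof.
move=> ab.
have : a \in [set c; d] by rewrite -ab set21.
have : b \in [set c; d] by rewrite -ab set22.
have : c \in [set a; b] by rewrite ab set21.
have : d \in [set a; b] by rewrite ab set22.
by do 4! [case/set2P => ?]; subst; auto.
Qed.

(** * Euclidean norm and unit vectors *)

Section EuclideanNorm.

Variables (R : realType) (d : nat).
Implicit Types (a : R) (v : 'cV[R]_d).

Lemma enorm_ge0 v : 0 <= enorm v.
Proof. exact: sqrtr_ge0. Qed.

Lemma enormZ a v : enorm (a *: v) = `|a| * enorm v.
Proof.
rewrite /enorm (eq_bigr (fun i => a ^+ 2 * v i 0 ^+ 2)).
  by rewrite -mulr_sumr sqrtrM ?sqr_ge0 // sqrtr_sqr.
by move=> i _; rewrite mxE exprMn.
Qed.

Lemma enormN v : enorm (- v) = enorm v.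
Proof. by rewrite -scaleN1r enormZ normrN1 mul1r. Qed.

Lemma enorm_eq0 v : (enorm v == 0) = (v == 0).
Proof.
apply/idP/eqP => [|->]; last first.
  by rewrite /enorm big1 ?sqrtr0 // => i _; rewrite mxE expr0n.
have s_ge0 : 0 <= \sum_i v i 0 ^+ 2 by apply: sumr_ge0 => i _; exact: sqr_ge0.
rewrite sqrtr_eq0 => s_le0.
have /eqP : \sum_i v i 0 ^+ 2 = 0 by apply/le_anti; rewrite s_le0.
rewrite psumr_eq0 => [/allP v0|i _]; last exact: sqr_ge0.
apply/colP => i; rewrite mxE.
by have := v0 i (mem_index_enum _); rewrite sqrf_eq0 => /eqP.
Qed.

Lemma enorm_gt0 v : (0 < enorm v) = (v != 0).
Proof. by rewrite lt0r enorm_ge0 andbT enorm_eq0. Qed.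

Lemma unitvK v : enorm v *: unitv v = v.
Proof.
rewrite /unitv scalerA; have [->|v_neq0] := eqVneq v 0; first by rewrite !scaler0.
by rewrite divff ?scale1r // enorm_eq0.
Qed.

Lemma unitvN v : unitv (- v) = - unitv v.
Proof. by rewrite /unitv enormN scalerN. Qed.

Lemma unitv_scale a v : 0 < a -> unitv (a *: v) = unitv v.
Proof.
move=> a_gt0; rewrite /unitv enormZ gtr0_norm // invfM scalerA mulrC mulrA.
by rewrite divff ?mul1r ?gt_eqF.
Qed.

Lemma enorm_unitv v : v != 0 -> enorm (unitv v) = 1.
Proof.
move=> v_neq0; rewrite /unitv enormZ ger0_norm ?invr_ge0 ?enorm_ge0 //.
by rewrite mulVf // enorm_eq0.
Qed.

End EuclideanNorm.

(** * Rotations, kernels and ranks *)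

Lemma rotVK (R : realType) (t : R) : (Defs.rot t)^T *m Defs.rot t = 1%:M.
Proof.
apply/matrixP => a b; rewrite !mxE !big_ord_recl big_ord0 !mxE /=.
have := cos2Dsin2 t.
by case: a => [[|[|a]] ?] //=; case: b => [[|[|b]] ?] //=; rewrite ?eqE /=;
  move: (cos t) (sin t) => x y xy; rewrite ?mulr1n ?mulr0n; lra.
Qed.

Lemma rot_inj (R : realType) (t : R) (u v : 'cV[R]_2) :
  Defs.rot t *m u = Defs.rot t *m v -> u = v.
Proof. by move=> /(congr1 (mulmx (Defs.rot t)^T)); rewrite !mulmxA rotVK !mul1mx. Qed.

(** Over a field, the column space of [A] is the annihilator of its left kernel. After transposition
    this is an inclusion of row spaces, tested by multiplying with [cokermx A^T], whose transpose
    lies in the left kernel of [A]. *)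
Lemma kermx_mul0_image (F : fieldType) (m n k : nat) (A : 'M[F]_(m, n))
    (W : 'M[F]_(m, k)) :
  kermx A *m W = 0 -> exists X, W = A *m X.
Proof.
move=> kW0; suff /submxP[X Wt] : (W^T <= A^T)%MS.
  by exists X^T; rewrite -[W]trmxK Wt trmx_mul trmxK.
rewrite submxE -[X in X == _]trmxK trmx_mul trmxK trmx_eq0.
have : ((cokermx A^T)^T <= kermx A)%MS.
  by apply/sub_kermxP; rewrite -[A in _ *m A]trmxK -trmx_mul mulmx_coker trmx0.
by case/submxP => D ->; rewrite -mulmxA kW0 mulmx0.
Qed.

Lemma exists_pos_shift (R : realFieldType) (m : nat) (u v : 'cV[R]_m) :
  (forall k, 0 < u k 0) ->
  exists2 eps, eps != 0 & forall k, 0 < (u + eps *: v) k 0.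
Proof.
(* The summand 1 makes [M] strictly larger than every ratio |v_k| / u_k, so each entry of v / M is
   smaller in absolute value than the corresponding entry of u. *)
move=> u_gt0; pose M := 1 + \sum_k `|v k 0| / u k 0.
have sum_ge0 k : 0 <= `|v k 0| / u k 0 by rewrite divr_ge0 // ltW.
have M_gt0 : 0 < M by rewrite ltr_wpDr // sumr_ge0.
exists M^-1 => [|k]; first by rewrite invr_eq0 gt_eqF.
have vk : `|v k 0| < u k 0 * M.
  rewrite mulrC -ltr_pdivrMr // /M (bigD1 k) //=.
  have : 0 <= \sum_(i < m | i != k) `|v i 0| / u i 0 by apply: sumr_ge0.
  by lra.
rewrite !mxE -(pmulr_rgt0 _ M_gt0) mulrDr mulrA divff ?gt_eqF // mul1r mulrC.
by move: vk; rewrite ltr_norml => /andP[]; lra.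
Qed.

Lemma col_injectiveP (F : fieldType) (m n : nat) (A : 'M[F]_(m, n)) :
  reflect (forall v : 'cV_n, A *m v = 0 -> v = 0) (\rank A == n).
Proof.
apply: (iffP idP) => [/row_fullP[L LA1] v Av0 | A_inj].
  by rewrite -[v]mul1mx -LA1 -mulmxA Av0 mulmx0.
suff coker0 : cokermx A = 0.
  rewrite eqn_leq rank_leq_col /= -subn_eq0 -mxrank_coker coker0.
  by rewrite mxrank0.
(* [A] annihilates each column of [cokermx A], so injectivity makes all these columns vanish. *)
apply/matrixP => i j; have := A_inj (col j (cokermx A)).
rewrite colE mulmxA mulmx_coker mul0mx => /(_ erefl) /colP/(_ i).
by rewrite -colE !mxE.
Qed.

Lemma mem_zip_pair (S T : eqType) (s : seq S) (t : seq T) x y :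
  (x, y) \in zip s t -> (x \in s) && (y \in t).
Proof.
elim: s t => [|a s IHs] [|b t] //=; rewrite !in_cons.
by case/orP => [/eqP[-> ->]|/IHs/andP[-> ->]]; rewrite ?eqxx ?orbT.
Qed.

(** * Planar configurations, bearings and lengths *)

Section Configurations.

Variables (R : realType) (n : nat).
Implicit Types x y : 'cV[R]_(n * 2).

Lemma loc_ext x y : (forall i, loc x i = loc y i) -> x = y.
Proof.
move=> xy; apply/colP => r; rewrite -(mxtens_unindexK r).
case: (mxtens_unindex r) => i a.
by have /colP/(_ a) := xy i; rewrite !mxE.
Qed.

Lemma bearingC x i j : bearing x j i = - bearing x i j.
Proof. by rewrite /bearing -unitvN opprB. Qed.

Lemma edge_lenC x i j : edge_len x j i = edge_len x i j.
Proof. by rewrite /edge_len -enormN opprB. Qed.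

Lemma edge_len_bearing x i j :
  edge_len x i j *: bearing x i j = loc x j - loc x i.
Proof. exact: unitvK. Qed.

Lemma edge_len_neq0 x i j : loc x i <> loc x j -> edge_len x i j != 0.
Proof. by move/eqP=> ?; rewrite enorm_eq0 subr_eq0 eq_sym. Qed.

Lemma enorm_bearing x i j : loc x i <> loc x j -> enorm (bearing x i j) = 1.
Proof. by move/eqP=> ?; rewrite enorm_unitv // subr_eq0 eq_sym. Qed.

(** Equality at [l] spreads along a path to any other vertex, one edge difference at a time. *)
Lemma loc_determined (g : rel 'I_n) (l : 'I_n) x y :
    connected_graph g -> loc x l = loc y l ->
    (forall i j, g i j -> loc x j - loc x i = loc y j - loc y i) -> x = y.
Proof.
move=> g_conn xyl xyg; apply: loc_ext => i.
have /connectP[s gs ->] := g_conn l i.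
elim: s l xyl gs => //= j s IHs l xyl /andP[glj gs]; apply: IHs gs.
by have := xyg _ _ glj; rewrite xyl => /addIr.
Qed.

(** The form of a configuration on which the incidence matrix acts from the left. *)
Definition loc_mx x : 'M[R]_(n, 2) := \matrix_(i, a) loc x i a 0.

Definition config_of_mx (X : 'M[R]_(n, 2)) : 'cV[R]_(n * 2) :=
  \col_r X (mxtens_unindex r).1 (mxtens_unindex r).2.

Lemma loc_config_of_mx X i : loc (config_of_mx X) i = (row i X)^T.
Proof. by apply/colP => a; rewrite !mxE mxtens_indexK. Qed.

End Configurations.

(** * Edge vectors and the Khatri-Rao product *)

Section EdgeField.

Variables (R : realType) (m : nat).

(** Row k is the transposed edge vector d_k b_k; in this layout the action of [khatri_rao P B] on
    [d] becomes an ordinary product with [P]. *)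
Definition edge_field (B : 'M[R]_(2, m)) (d : 'cV[R]_m) : 'M[R]_(m, 2) :=
  \matrix_(k, a) (d k 0 * B a k).

Lemma khatri_rao_mulE (c : nat) (P : 'M[R]_(c, m)) B (d : 'cV[R]_m) i a :
  (khatri_rao P B *m d) (mxtens_index (i, a)) 0 = (P *m edge_field B d) i a.
Proof.
rewrite !mxE; apply: eq_bigr => k _.
rewrite !mxE mxtens_indexK /= -mulrA; congr (_ * _).
by rewrite mulrC.
Qed.

Lemma khatri_rao_mul0 (c : nat) (P : 'M[R]_(c, m)) B (d : 'cV[R]_m) :
  khatri_rao P B *m d = 0 <-> P *m edge_field B d = 0.
Proof.
split=> [/colP PBd0 | /matrixP PBd0].
  by apply/matrixP => i a; rewrite -khatri_rao_mulE PBd0 !mxE.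
apply/colP => r; rewrite -(mxtens_unindexK r).
by case: (mxtens_unindex r) => i a; rewrite khatri_rao_mulE PBd0 !mxE.
Qed.

Lemma loc_reconstruct (n : nat) (p : 'cV[R]_(n * 2)) l (P : 'M[R]_(n, m)) B d i :
  loc (reconstruct p l P B d) i = loc p l + (row i (P *m edge_field B d))^T.
Proof.
(* The tensor product of two columns has its only column indexed by a pair, the form that [tensmxE]
   expects. *)
have col0 : (0 : 'I_(1 * 1)) = mxtens_index (0, 0) by apply: val_inj.
apply/colP => a; rewrite mxE mxE khatri_rao_mulE [RHS]mxE; congr (_ + _).
  have := tensmxE (const_mx 1 : 'cV[R]_n) (loc p l) i a 0 0.
  by rewrite -col0 [const_mx _ _ _]mxE mul1r.
by rewrite !mxE.
Qed.

End EdgeField.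

(** * Oriented edges, cycle space and tree paths *)

Section Orientation.

Variables (R : realType) (n m : nat) (g : rel 'I_n) (o : 'I_m -> 'I_n * 'I_n).
Hypotheses (g_sym : symmetric g) (g_irr : irreflexive g).
Hypothesis o_orient : orientation g o.
Implicit Types (x : 'cV[R]_(n * 2)) (B : 'M[R]_(2, m)) (d : 'cV[R]_m).

Lemma orient_edge k : g (o k).1 (o k).2.
Proof.
have : [set (o k).1; (o k).2] \in edge_set g.
  by rewrite -o_orient.2; apply/imsetP; exists k.
case/imsetP => -[i j]; rewrite inE /= => gij /set2_eq[] [-> ->] //.
by rewrite g_sym.
Qed.

Lemma edge_orient i j : g i j -> exists k, o k = (i, j) \/ o k = (j, i).
Proof.
move=> gij; have : [set i; j] \in edge_set g.
  by apply/imsetP; exists (i, j); rewrite ?inE.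
rewrite -o_orient.2 => /imsetP[k _ /set2_eq ok]; exists k.
by rewrite [o k]surjective_pairing; case: ok => -[-> ->]; auto.
Qed.

Lemma is_edge_orient k' k : is_edge o k' (o k).1 (o k).2 = (k' == k).
Proof. exact: (inj_eq o_orient.1). Qed.

Lemma is_edgeC k i j : is_edge o k j i = is_edge o k i j.
Proof. by rewrite /is_edge [[set j; i]]setUC. Qed.

(** Distinct indices number distinct unoriented edges, and in the absence of loops the two
    indicators cannot cancel at the edge itself. *)
Lemma edge_sign_orient k' k : edge_sign R o k' (o k).1 (o k).2 = (k' == k)%:R.
Proof.
have := orient_edge k; rewrite /edge_sign -surjective_pairing.
case oke: (o k) => [i j] /= gij.
have [->|k'k] := eqVneq k' k.
  rewrite oke eqxx; case: eqP gij => [[-> _]|_ _]; first by rewrite g_irr.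
  by rewrite subr0.
have : ~~ is_edge o k' i j.
  by have := is_edge_orient k' k; rewrite oke (negbTE k'k) => ->.
rewrite /is_edge => nk'; case: eqP => [ok'|_].
  by rewrite ok' eqxx in nk'.
case: eqP => [ok'|_]; last by rewrite subrr.
by rewrite ok' setUC eqxx in nk'.
Qed.

Lemma edge_signC k i j : edge_sign R o k j i = - edge_sign R o k i j.
Proof. by rewrite opprB. Qed.

Lemma edge_bearingC B i j : edge_bearing o B j i = - edge_bearing o B i j.
Proof.
by rewrite -sumrN; apply: eq_bigr => k _; rewrite edge_signC scaleNr.
Qed.

Lemma edge_bearing_orient B k : edge_bearing o B (o k).1 (o k).2 = col k B.
Proof.
rewrite /edge_bearing (bigD1 k) //= edge_sign_orient eqxx scale1r big1 ?addr0 //.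
by move=> k' /negbTE k'k; rewrite edge_sign_orient k'k scale0r.
Qed.

(** Both sides change sign when [i] and [j] are exchanged, so the stored orientation of the edge
    suffices. *)
Lemma edge_bearing_mx x i j :
  g i j -> edge_bearing o (bearing_mx o x) i j = bearing x i j.
Proof.
have colE k : col k (bearing_mx o x) = bearing x (o k).1 (o k).2.
  by apply/colP => a; rewrite !mxE.
case/edge_orient => k; have := edge_bearing_orient (bearing_mx o x) k.
by rewrite colE => + [] ok; rewrite ok //= bearingC edge_bearingC => /oppr_inj.
Qed.

Lemma edge_bearing_inj B B' :
  (forall i j, g i j -> edge_bearing o B i j = edge_bearing o B' i j) -> B = B'.
Proof.
move=> BB'; apply/matrixP => a k.
have := BB' _ _ (orient_edge k); rewrite !edge_bearing_orient.
by move/colP/(_ a); rewrite !mxE.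
Qed.

(** The entry of [d] at the unoriented edge {i, j}, in the form in which the rows of [D0] produce
    it; it is 0 if no index carries that edge. *)
Definition edge_coef d i j : R := \sum_k (is_edge o k i j)%:R * d k 0.

Lemma edge_coef_orient d k : edge_coef d (o k).1 (o k).2 = d k 0.
Proof.
rewrite /edge_coef (bigD1 k) //= is_edge_orient eqxx mul1r big1 ?addr0 //.
by move=> k' /negbTE k'k; rewrite is_edge_orient k'k mul0r.
Qed.

Lemma edge_coefC d i j : edge_coef d j i = edge_coef d i j.
Proof. by apply: eq_bigr => k _; rewrite is_edgeC. Qed.

Definition edge_lens x : 'cV[R]_m := \col_k edge_len x (o k).1 (o k).2.

Lemma edge_coef_lens x i j : g i j -> edge_coef (edge_lens x) i j = edge_len x i j.
Proof.
case/edge_orient => k; have := edge_coef_orient (edge_lens x) k.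
by rewrite mxE => + [] ok; rewrite ok //= edge_coefC edge_lenC.
Qed.

Lemma incidence_mulE (r : nat) (X : 'M[R]_(n, r)) k a :
  (incidence_mx R o *m X) k a = X (o k).2 a - X (o k).1 a.
Proof.
rewrite mxE (eq_bigr (fun i => (i == (o k).2)%:R * X i a
                               - (i == (o k).1)%:R * X i a)); last first.
  by move=> i _; rewrite mxE mulrBl ![i == _]eq_sym.
rewrite sumrB (bigD1 (o k).2) //= eqxx mul1r big1 => [|i /negbTE ->]; last first.
  by rewrite mul0r.
rewrite (bigD1 (o k).1) //= eqxx mul1r big1 => [|i /negbTE ->]; last first.
  by rewrite mul0r.
by rewrite !addr0.
Qed.

Lemma edge_field_bearing x :
  edge_field (bearing_mx o x) (edge_lens x) = incidence_mx R o *m loc_mx x.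
Proof.
apply/matrixP => k a; rewrite incidence_mulE !mxE.
have /colP/(_ a) := edge_len_bearing x (o k).1 (o k).2.
by rewrite !mxE.
Qed.

(** Only the row space of [C] matters. It is the left kernel of the incidence matrix, and what this
    kernel annihilates is exactly the image of that matrix: [X] is a potential with edge differences
    [W]. *)
Lemma cycle_basis_mul0 (c k : nat) (C : 'M[R]_(c, m)) (W : 'M[R]_(m, k)) :
  cycle_basis_mx g o C -> C *m W = 0 <-> exists X, W = incidence_mx R o *m X.
Proof.
case=> _ _ /andP[C_sub C_sup]; split=> [CW0 | [X ->]].
  apply: kermx_mul0_image; have /submxP[D] := C_sup.
  by rewrite /cycle_space => ->; rewrite -mulmxA CW0 mulmx0.
have /sub_kermxP CI0 : (C <= kermx (incidence_mx R o))%MS by [].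
by rewrite mulmxA CI0 mul0mx.
Qed.

Lemma sum_edge_sign (f : 'I_n -> R) i j : g i j ->
  \sum_k edge_sign R o k i j * (f (o k).2 - f (o k).1) = f j - f i.
Proof.
case/edge_orient => k.
have : \sum_k' edge_sign R o k' (o k).1 (o k).2 * (f (o k').2 - f (o k').1)
       = f (o k).2 - f (o k).1.
  rewrite (bigD1 k) //= edge_sign_orient eqxx mul1r big1 ?addr0 //.
  by move=> k' /negbTE k'k; rewrite edge_sign_orient k'k mul0r.
move=> + [] ok; rewrite ok //= => sum_ji; rewrite -[RHS]opprB -sum_ji -sumrN.
by apply: eq_bigr => k' _; rewrite edge_signC mulNr.
Qed.

(* Since l :: s has no repeated vertex, no arc of it occurs twice or in both
   directions, so the coefficient of each arc is its [edge_sign]. *)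
Lemma sum_path_arcs (f : 'I_n -> R) l s :
  path g l s -> uniq (l :: s) ->
  \sum_k ((((o k).1, (o k).2) \in zip (l :: s) s)%:R
          - (((o k).2, (o k).1) \in zip (l :: s) s)%:R)
         * (f (o k).2 - f (o k).1) = f (last l s) - f l.
Proof.
elim: s l => [|j s IHs] l /=.
  by move=> _ _; rewrite big1 ?subrr // => k _; rewrite mul0r.
case/andP=> glj gs /andP[l_notin us].
have memD u v : (((u, v) \in (l, j) :: zip (j :: s) s)%:R : R)
    = ((u, v) == (l, j))%:R + ((u, v) \in zip (j :: s) s)%:R.
  rewrite in_cons; case: eqP => [[-> ->]|_]; last by rewrite add0r.
  have -> : ((l, j) \in zip (j :: s) s) = false.
    by apply/negP => /mem_zip_pair /andP[]; rewrite (negbTE l_notin).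
  by rewrite addr0.
rewrite -[RHS](subrKA (f j)) -(IHs j gs us) -(sum_edge_sign f glj).
rewrite addrC -big_split; apply: eq_bigr => k _ /=.
rewrite !memD -mulrDl; congr (_ * _); rewrite /edge_sign.
have -> : (((o k).2, (o k).1) == (l, j)) = (o k == (j, l)).
  by case: (o k) => u v; rewrite !xpair_eqE andbC.
by rewrite -surjective_pairing opprD addrACA.
Qed.

(** Lengths times bearings are the edge differences of [x], and these telescope along the tree path
    from [l] to each vertex. *)
Lemma reconstruct_edge_lens x l tr (P : 'M[R]_(n, m)) :
  subrel tr g -> connected_graph tr -> path_matrix tr o l P ->
  reconstruct x l P (bearing_mx o x) (edge_lens x) = x.
Proof.
move=> tr_g tr_conn pathP; apply: loc_ext => i.
have /connectP[s0 trs0 ->] := tr_conn l i.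
(* [P] is specified only through paths without repeated vertices, so the walk is shortened first. *)
case: (shortenP trs0) => s trs us _.
apply/colP => a; rewrite loc_reconstruct.
have -> : loc x (last l s) a 0
    = loc x l a 0 + (loc x (last l s) a 0 - loc x l a 0) by rewrite addrC subrK.
have tr_path : path g l s by apply: sub_path trs.
rewrite mxE; congr (_ + _); rewrite 2!mxE mxE.
rewrite -(sum_path_arcs (fun i => loc x i a 0) tr_path us).
apply: eq_bigr => k _; rewrite (pathP _ _ trs us erefl); congr (_ * _).
have /colP/(_ a) := edge_len_bearing x (o k).1 (o k).2.
by rewrite !mxE.
Qed.

End Orientation.

(** * Feasible points and the two linear systems *)

Section Network.

Variables (R : realType) (n na m c : nat) (e : rel 'I_n) (VA VD : {set 'I_n}).
Variables (p : 'cV[R]_(n * 2)) (theta kappa : 'I_n -> 'I_n -> 'I_n -> R).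
Variables (o : 'I_m -> 'I_n * 'I_n) (C : 'M[R]_(c, m)).
Hypotheses (e_sym : symmetric e) (e_irr : irreflexive e).

Local Notation g := (hat na e).
Local Notation feasible := (feasible na g VA VD theta kappa p).
Local Notation CDp := (CD na g VD kappa o C (bearing_mx o p)).
Local Notation y := (yvec na c g VD p).
Local Notation S1 := (S1 na g VA theta o p).

Lemma hat_sym : symmetric g.
Proof.
move=> i j; rewrite /hat e_sym eq_sym; congr (_ || (_ && _)).
by rewrite andbC.
Qed.

Lemma hat_irr : irreflexive g.
Proof. by move=> i; rewrite /hat e_irr eqxx. Qed.

Lemma hat_conn : connected_graph e -> connected_graph g.
Proof.
move=> e_conn i j; apply: connect_sub (e_conn i j) => u v euv.
by apply: connect1; rewrite /hat euv.
Qed.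

Lemma hat_anchors i j :
  i \in anchors n na -> j \in anchors n na -> i != j -> g i j.
Proof. by rewrite /hat => -> -> ->; rewrite orbT. Qed.

Lemma CD_mulP (B : 'M[R]_(2, m)) (d : 'cV[R]_m) :
  CD na g VD kappa o C B *m d = y <->
  [/\ C *m edge_field B d = 0,
      forall i j l, (i, j, l) \in triples g VD ->
        edge_coef o d i l = kappa i j l * edge_coef o d i j
    & forall s t, (s, t) \in anchor_pairs n na ->
        edge_coef o d s t = edge_len p s t].
Proof.
rewrite /CD /D0 /yvec !mul_col_mx; split.
  case/eq_col_mx => /khatri_rao_mul0 Cd0 /eq_col_mx[/colP tripd /colP anchd].
  split=> // [i j l ijl | s t st].
    (* The equation of a triple is the row numbered by its rank in the enumeration. *)
    have := tripd (enum_rank_in ijl (i, j, l)).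
    rewrite !mxE (eq_bigr (fun k => - kappa i j l * ((is_edge o k i j)%:R * d k 0)
                               + (is_edge o k i l)%:R * d k 0)); last first.
      by move=> k _; rewrite mxE enum_rankK_in // mulrDl mulrA.
    rewrite big_split -mulr_sumr /= mulNr addrC => /eqP.
    by rewrite subr_eq0 => /eqP.
  have := anchd (enum_rank_in st (s, t)).
  rewrite !mxE enum_rankK_in // => <-.
  by apply: eq_bigr => k _; rewrite mxE enum_rankK_in.
case=> /khatri_rao_mul0 -> tripd anchd; congr (col_mx _ (col_mx _ _)).
  apply/colP => r; rewrite !mxE; move: (enum_valP r).
  case Er: (enum_val r) => [[i j] l] /tripd ijl.
  rewrite (eq_bigr (fun k => - kappa i j l * ((is_edge o k i j)%:R * d k 0)
                               + (is_edge o k i l)%:R * d k 0)); last first.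
    by move=> k _; rewrite mxE Er mulrDl mulrA.
  rewrite big_split -mulr_sumr /= mulNr addrC; apply/eqP.
  by rewrite subr_eq0; apply/eqP.
apply/colP => r; rewrite !mxE; move: (enum_valP r).
case Er: (enum_val r) => [s t] /anchd <-.
by apply: eq_bigr => k _; rewrite mxE Er.
Qed.

Hypotheses (p_distinct : injective (loc p)).
Hypothesis theta_p : forall i j k, (i, j, k) \in triples g VA ->
  bearing p i k = Defs.rot (theta i j k) *m bearing p i j.
Hypothesis kappa_def : forall r s t, (r, s, t) \in triples g VD ->
  kappa r s t = edge_len p r t / edge_len p r s.
Hypotheses (o_orient : orientation g o) (C_basis : cycle_basis_mx g o C).
Hypothesis TA_conn : triples_connected g (triples g VA).
Hypotheses (e_conn : connected_graph e).
Variables (a0 a1 : 'I_n).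
Hypotheses (a0_anchor : a0 \in anchors n na) (a1_anchor : a1 \in anchors n na).
Hypothesis a01 : a0 != a1.

Let g_sym := hat_sym.
Let g_irr := hat_irr.

Lemma true_feasible : feasible p.
Proof.
split=> // [i j gij /p_distinct ij | r s t rst].
  by rewrite ij hat_irr in gij.
by rewrite kappa_def.
Qed.

Lemma feasible_S1 x : feasible x -> S1 (bearing_mx o x).
Proof.
case=> [_ thx _ anx]; split=> [i j k ijk | i j ia ja /eqP ij].
  have := ijk; rewrite inE /= => /and4P[_ gij gik _].
  by rewrite !(edge_bearing_mx g_sym g_irr o_orient) // (thx _ _ _ ijk) subrr.
rewrite (edge_bearing_mx g_sym g_irr o_orient) //; last exact: hat_anchors.
by rewrite /bearing !anx.
Qed.

(** The anchor data fix the bearing of the edge between [a0] and [a1]. Agreement then passes from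
    edge to adjacent edge, since the angle equation determines either bearing from the other. *)
Lemma S1_unique B B' : S1 B -> S1 B' -> B = B'.
Proof.
case=> [thB anB] [thB' anB']; apply: (edge_bearing_inj g_sym g_irr o_orient).
move=> i j gij.
(* Adjacency concerns unoriented edges, so agreement is required for every naming of the
   endpoints. *)
pose agree (f : {set 'I_n}) := forall u v, f = [set u; v] ->
  edge_bearing o B u v = edge_bearing o B' u v.
have agreeI u v : edge_bearing o B u v = edge_bearing o B' u v ->
    agree [set u; v].
  move=> uv u' v' /set2_eq[] [<- <-] //.
  by rewrite ![edge_bearing _ _ v u]edge_bearingC uv.
have agree0 : agree [set a0; a1].
  by apply: agreeI; rewrite anB ?anB' //; apply/eqP.
have edge_in u v : g u v -> [set u; v] \in edge_set g.
  by move=> guv; apply/imsetP; exists (u, v); rewrite ?inE.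
have g01 : g a0 a1 by apply: hat_anchors.
have /connectP[s adj_s] := TA_conn (edge_in _ _ g01) (edge_in _ _ gij).
suff : agree (last [set a0; a1] s) by move=> + eq_ij; rewrite -eq_ij; apply.
elim: s [set a0; a1] agree0 adj_s => //= f2 s IHs f1 agree1 /andP[adj12].
apply: IHs; have /existsP[u /existsP[v /existsP[w]]] := adj12.
(* The triple may list the known edge first or second: in one case its bearing is rotated forward,
   in the other the rotation is cancelled by [rot_inj]. *)
case/and4P=> _ /eqP f1E /eqP-> /orP[] uvw; apply: agreeI.
  have /eqP := thB _ _ _ uvw; have /eqP := thB' _ _ _ uvw.
  by rewrite !subr_eq0 => /eqP-> /eqP->; rewrite (agree1 _ _ f1E).
have /eqP := thB _ _ _ uvw; have /eqP := thB' _ _ _ uvw.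
by rewrite !subr_eq0 (agree1 _ _ f1E) => /eqP-> /eqP /rot_inj.
Qed.

Lemma feasible_bearing x : feasible x -> bearing_mx o x = bearing_mx o p.
Proof.
move=> /feasible_S1 S1x; apply: S1_unique S1x _.
exact: feasible_S1 true_feasible.
Qed.

Lemma anchor_pair_edge s t : (s, t) \in anchor_pairs n na -> g s t.
Proof.
rewrite inE /= => /and3P[sa ta st]; apply: hat_anchors => //.
by rewrite neq_ltn st.
Qed.

Lemma feasible_CD x : feasible x -> CDp *m edge_lens o x = y.
Proof.
move=> fx; have [nex _ kx anx] := fx; apply/CD_mulP; split.
(* The edge vectors of [x] are differences of its points, so they are orthogonal to every cycle. *)
- rewrite -(feasible_bearing fx) edge_field_bearing.
  by apply/(cycle_basis_mul0 _ C_basis); exists (loc_mx x).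
- move=> i j l ijl; have := ijl; rewrite inE /= => /and4P[_ gij gil _].
  rewrite !(edge_coef_lens o_orient) // -(kx _ _ _ ijl) divfK //.
  by apply: edge_len_neq0; apply: nex.
- move=> s t st; rewrite (edge_coef_lens o_orient) ?anchor_pair_edge //.
  by have := st; rewrite inE /= => /and3P[sa ta _]; rewrite /edge_len !anx.
Qed.

(** The bearings are common to all feasible points, so equal lengths give equal edge differences,
    and the anchor [a0] excludes a translation. *)
Lemma edge_lens_inj x x' :
  feasible x -> feasible x' -> edge_lens o x = edge_lens o x' -> x = x'.
Proof.
move=> fx fx' xx'; have [_ _ _ anx] := fx; have [_ _ _ anx'] := fx'.
apply: (loc_determined (l := a0) (hat_conn e_conn)); first by rewrite anx ?anx'.
move=> i j gij; rewrite -!edge_len_bearing -!(edge_coef_lens o_orient) // xx'.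
rewrite -!(edge_bearing_mx g_sym g_irr o_orient) //.
by rewrite (feasible_bearing fx) (feasible_bearing fx').
Qed.

(** The cycle rows yield a potential whose edge vectors are d_k b_k. Positivity of [d] is what makes
    b_k the bearing and d_k the length of such a vector. *)
Lemma CD_feasible (d : 'cV[R]_m) : (forall k, 0 < d k 0) -> CDp *m d = y ->
  exists2 x, feasible x & edge_lens o x = d.
Proof.
move=> d_gt0 /CD_mulP[/(cycle_basis_mul0 _ C_basis)[X fieldX] tripd anchd].
(* A potential is determined only up to translation; this one puts [a0] at its true location. *)
pose x := config_of_mx (\matrix_i (row i X - row a0 X + (loc p a0)^T)).
have locB i j : loc x j - loc x i = (row j X - row i X)^T.
  by apply/colP => a; rewrite !loc_config_of_mx !rowK !mxE; ring.
have locD k : loc x (o k).2 - loc x (o k).1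
    = d k 0 *: bearing p (o k).1 (o k).2.
  apply/colP => a; rewrite locB; move/matrixP/(_ k a): fieldX.
  by rewrite incidence_mulE !mxE.
have nek k : loc p (o k).1 <> loc p (o k).2.
  move=> /p_distinct ok; have := orient_edge g_sym o_orient k.
  by rewrite ok hat_irr.
have bx k : bearing x (o k).1 (o k).2 = bearing p (o k).1 (o k).2.
  rewrite /bearing locD unitv_scale // -edge_len_bearing unitv_scale //.
  by rewrite lt0r edge_len_neq0 ?enorm_ge0.
have lens : edge_lens o x = d.
  apply/colP => k; rewrite mxE /edge_len locD enormZ enorm_bearing //.
  by rewrite mulr1 gtr0_norm.
have bmx : bearing_mx o x = bearing_mx o p.
  by apply/matrixP => a k; rewrite mxE [RHS]mxE bx.
have bxg i j : g i j -> bearing x i j = bearing p i j.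
  by move=> gij; rewrite -!(edge_bearing_mx g_sym g_irr o_orient) // bmx.
have lxg i j : g i j -> edge_len x i j = edge_coef o d i j.
  by move=> gij; rewrite -lens (edge_coef_lens o_orient).
have lx_gt0 i j : g i j -> 0 < edge_len x i j.
  case/(edge_orient o_orient) => k; have := d_gt0 k.
  by rewrite -lens mxE => + [] ok; rewrite ok // edge_lenC.
have locx0 : loc x a0 = loc p a0.
  by apply/colP => a; rewrite loc_config_of_mx !mxE; ring.
exists x => //; split=> [i j gij ij | i j k ijk | r s t rst | i ia].
- by have := lx_gt0 _ _ gij; rewrite enorm_gt0 ij subrr eqxx.
- have := ijk; rewrite inE /= => /and4P[_ gij gik _].
  by rewrite !bxg //; exact: theta_p.
- have := rst; rewrite inE /= => /and4P[_ grs grt _].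
  by rewrite !lxg // (tripd _ _ _ rst) mulfK // -lxg // gt_eqF // lx_gt0.
(* Any other anchor is joined to [a0] by an edge whose bearing is that of [p] and whose length is
   prescribed by an anchor row. *)
- have [<- // | a0i] := eqVneq a0 i.
  have g0i : g a0 i by apply: hat_anchors.
  apply: (addIr (- loc p a0)); rewrite -{1}locx0 -!edge_len_bearing bxg // lxg //.
  (* Anchor rows exist only for increasing pairs, hence the case distinction on the order. *)
  congr (_ *: _); have [a0_lt | a0_gt | /val_inj a0E] := ltngtP a0 i.
  + by rewrite anchd // inE /= a0_anchor ia.
  + by rewrite edge_coefC edge_lenC anchd // inE /= a0_anchor ia.
  + by rewrite a0E eqxx in a0i.
Qed.

Lemma feasible_uniqueP :
  (exists! x, feasible x) <-> \rank CDp = m.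
Proof.
have fp := true_feasible; split=> [[x0 [_ uniq0]] | /eqP/col_injectiveP CDp_inj].
  apply/eqP/col_injectiveP => v CDv0; apply/eqP/contraT => v_neq0.
  have lens_gt0 k : 0 < edge_lens o p k 0.
    rewrite mxE lt0r enorm_ge0 andbT edge_len_neq0 // => /p_distinct ok.
    by have := orient_edge g_sym o_orient k; rewrite ok hat_irr.
  have [eps eps_neq0 d_gt0] := exists_pos_shift v lens_gt0.
  have [|x fx lens_x] := CD_feasible d_gt0.
    by rewrite mulmxDr -scalemxAr CDv0 scaler0 addr0 feasible_CD.
  (* Uniqueness identifies the perturbed point with [p], so their lengths agree and the shift is
     zero. *)
  have /eqP : eps *: v = 0.
    by apply: (addrI (edge_lens o p)); rewrite -lens_x addr0 -(uniq0 _ fx) (uniq0 _ fp).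
  by rewrite scaler_eq0 (negbTE eps_neq0) (negbTE v_neq0).
exists p; split=> // x fx; apply: edge_lens_inj => //; apply/eqP.
rewrite -subr_eq0; apply/eqP/CDp_inj.
by rewrite mulmxBr !feasible_CD ?subrr.
Qed.

(** The bearings of [p] are the only solution of (S1) and, by full rank, the lengths of [p] are the
    only solution for [d]; the reconstruction therefore returns [p] itself. *)
Lemma rank_algorithm_solves :
  \rank CDp = m -> algorithm_solves na g VA VD theta kappa o C p.
Proof.
move/eqP/col_injectiveP => CDp_inj.
have fp := true_feasible; have S1p := feasible_S1 fp; split.
  by exists (bearing_mx o p); split=> // B; exact: S1_unique.
move=> B /(S1_unique S1p) <-.
have d_unique d : CDp *m d = y -> edge_lens o p = d.
  move=> CDd; apply/eqP; rewrite -subr_eq0; apply/eqP/CDp_inj.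
  by rewrite mulmxBr feasible_CD // CDd subrr.
split=> [|d /d_unique <- l tr P _ [_ tr_g tr_conn _] pathP].
  by exists (edge_lens o p); split=> //; exact: feasible_CD.
by rewrite (reconstruct_edge_lens g_sym g_irr o_orient _ tr_g tr_conn pathP).
Qed.

End Network.

Theorem theorem13 (R : realType) (n na m : nat) (e : rel 'I_n)
    (VA VD : {set 'I_n}) (p : 'cV[R]_(n * 2))
    (theta kappa : 'I_n -> 'I_n -> 'I_n -> R)
    (o : 'I_m -> 'I_n * 'I_n) (C : 'M[R]_(m.+1 - n, m))
    (n_ge3 : (3 <= n)%N) (na_le_n : (na <= n)%N)
    (e_sym : symmetric e) (e_irr : irreflexive e) (e_conn : connected_graph e)
    (VAD_cover : VA :|: VD = [set: 'I_n]) (VAD_disj : [disjoint VA & VD])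
    (VA_neq0 : VA != set0) (VD_neq0 : VD != set0)
    (p_distinct : injective (loc p))
    (theta_def : forall i j k, (i, j, k) \in triples (hat na e) VA ->
       is_ccw_angle (theta i j k) (loc p j - loc p i) (loc p k - loc p i))
    (kappa_def : forall r s t, (r, s, t) \in triples (hat na e) VD ->
       kappa r s t = edge_len p r t / edge_len p r s)
    (m_def : m = #|edge_set (hat na e)|)
    (o_orient : orientation (hat na e) o)
    (C_basis : cycle_basis_mx (hat na e) o C)
    (pb1_feasible : exists x, feasible na (hat na e) VA VD theta kappa p x)
    (anchor_VA : anchors n na :&: VA != set0)
    (anchor_VD : anchors n na :&: VD != set0)
    (TA_conn : triples_connected (hat na e) (triples (hat na e) VA)) :
  (sarod_localizable na (hat na e) VA VD theta kappa p <->
     \rank (CD na (hat na e) VD kappa o C (bearing_mx o p)) = m)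
  /\ (\rank (CD na (hat na e) VD kappa o C (bearing_mx o p)) = m ->
      algorithm_solves na (hat na e) VA VD theta kappa o C p).
Proof.
have /set0Pn[a0 /setIP[a0_anchor a0_VA]] := anchor_VA.
have /set0Pn[a1 /setIP[a1_anchor a1_VD]] := anchor_VD.
(* One anchor is in [VA] and the other in the disjoint set [VD], so there is an edge between two
   anchors whose known bearing starts the propagation. *)
have a01 : a0 != a1.
  by apply: contraTneq a1_VD => <-; rewrite (disjointFr VAD_disj).
have theta_p i j k : (i, j, k) \in triples (hat na e) VA ->
    bearing p i k = Defs.rot (theta i j k) *m bearing p i j.
  by case/theta_def.
split.
  exact: (feasible_uniqueP e_sym e_irr p_distinct theta_p kappa_def o_orient
            C_basis TA_conn e_conn a0_anchor a1_anchor a01).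
exact: (rank_algorithm_solves e_sym e_irr p_distinct theta_p kappa_def o_orient
          C_basis TA_conn a0_anchor a1_anchor a01).
Qed.
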